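(* Let $G$ be a plane triangulation with $n$ vertices and minimum degree $\delta(G)\ge 4$, and suppose $G$ contains a Hamilton cycle $H$. Then $\gamma(G)\le \max\{\lceil 2n/7\rceil, \lfloor 5n/16\rfloor\}$.
   Context: $\gamma(G)$ denotes the domination number of $G$, i.e. the minimum size of a set $D\subseteq V(G)$ such that every vertex of $G$ is in $D$ or adjacent to a vertex of $D$. A plane triangulation is a simple planar graph embedded in the plane in which every face (including the outer face) is bounded by a triangle. *)

(* Defs.v *)
From mathcomp Require Import all_boot perm.

Set Implicit Arguments.
Unset Strict Implicit.
Unset Printing Implicit Defensive.

Record sgraph (V : finType) := SGraph {
  adj :> rel V;
  adj_sym : symmetric adj;
  adj_irr : irreflexive adj
}.

Section Graph.

Variables (V : finType) (G : sgraph V).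
Implicit Types (u v w : V) (D : {set V}).

Definition nbrs v : {set V} := [set u | adj G v u].

Definition degree v : nat := #|nbrs v|.

(* Every degree is < #|V|, so the default value #|V| never matters when V is
   nonempty. *)
Definition min_degree : nat := \big[minn/#|V|]_v degree v.

Definition dominating D : bool :=
  [forall v, (v \in D) || [exists u in D, adj G u v]].

Definition domination_number : nat :=
  #|[arg min_(D < [set: V] | dominating D) #|D|]|.

Lemma dominating_setT : dominating [set: V].
Proof. by apply/forallP => v; rewrite inE. Qed.

Lemma domination_number_min :
  (exists2 D, dominating D & #|D| = domination_number) /\
  (forall D, dominating D -> domination_number <= #|D|).
Proof.
rewrite /domination_number; case: arg_minnP; first exact: dominating_setT.
by move=> D domD minD; split=> //; exists D.
Qed.

(* A Hamilton cycle, listed as the cyclic sequence of its vertices. *)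
Definition hamilton_cycle (H : seq V) : Prop :=
  [/\ 2 < size H, cycle (adj G) H, uniq H & forall v, v \in H].

Definition connected : Prop := forall u v, connect (adj G) u v.

(* The edge uv gives two darts, (u, v) and (v, u). *)
Definition darts : {set V * V} := [set d | adj G d.1 d.2].

Definition edges : {set {set V}} := [set [set d.1; d.2] | d in darts].

(* Embeddings are represented by rotation systems, the Heffter-Edmonds
   description of an embedding of a connected graph in an oriented surface with
   all faces discs, up to homeomorphism: rot v is the cyclic permutation of the
   neighbours of v in the order in which the edges leave v. *)
Definition rotation_system (rot : V -> {perm V}) : Prop :=
  forall v, perm_on (nbrs v) (rot v) /\
            {in nbrs v &, forall u w, w \in porbit (rot v) u}.

(* Facial walks: after traversing uv, leave v by the edge following vu in the
   rotation at v. The faces are the orbits of this map on the darts. *)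
Definition face_step (rot : V -> {perm V}) (d : V * V) : V * V :=
  (d.2, rot d.2 d.1).

Definition nb_faces (rot : V -> {perm V}) : nat := fcard (face_step rot) darts.

(* fcard counts the orbits in an invariant set of an injective map, which is
   the case here. *)
Lemma face_step_inj rot : injective (face_step rot).
Proof. by case=> [u v] [u' v'] [<-] /perm_inj ->. Qed.

Lemma face_step_darts rot d :
  rotation_system rot -> (face_step rot d \in darts) = (d \in darts).
Proof.
case: d => u v /(_ v) [rotv _]; rewrite !inE /= (adj_sym G u v).
by have := perm_closed u rotv; rewrite !inE.
Qed.

(* A plane embedding is one in the sphere, one face being the outer one: among
   the connected closed oriented surfaces, the sphere is the one of Euler
   characteristic #|V| - #|E| + #|F| = 2. *)
Definition plane_embedding (rot : V -> {perm V}) : Prop :=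
  [/\ connected, rotation_system rot & #|V| + nb_faces rot = #|edges| + 2].

(* A closed walk of length 3 in a simple graph is a triangle. Connectedness,
   included in plane_embedding, is no restriction: a disconnected plane graph
   has a face whose boundary is disconnected. *)
Definition plane_triangulation (rot : V -> {perm V}) : Prop :=
  plane_embedding rot /\
  (forall d, d \in darts -> order (face_step rot) d = 3).

End Graph.

(* The ceiling of m / d, for d > 0. *)
Definition ceil_div (m d : nat) : nat := (m + d.-1) %/ d.

(* Main.v *)
Require Import Defs.
From mathcomp Require Import all_boot perm zify.

(* The Hamilton cycle cuts the sphere into two triangulated polygons on all n
   vertices. Colour the vertices of one polygon with four colours so that any two
   triangles sharing a chord receive all four. A vertex incident with a chord of the
   polygon then sees every colour, while an ear (a vertex with no chord on that side)
   misses exactly one; adding the ears to the classes they miss gives four dominating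
   sets of total size n + t, with t the number of ears, so 4 gamma <= n + t.
   Since no vertex is an ear on both sides, this settles n <= 6, and also the case
   where one side has few ears. Otherwise ears of either kind form more than half of
   the cycle, by a margin depending on n modulo 16. The two neighbours of an ear are
   adjacent, so one vertex dominates four or five consecutive vertices of the cycle
   around ears. Weight ears by 4 and other vertices by 6: greedy blocks weigh at least
   16, and the total weight is less than 5n. The rounding loss is at most 12; a
   rotation in which ears prevail in every initial segment leaves finitely many words
   where the blocks do not make up for it, and these are checked by computation. *)

Set Implicit Arguments.
Unset Strict Implicit.
Unset Printing Implicit Defensive.

(** * Covering a cyclic word *)

Section Words.

Implicit Types (u v w b : seq bool).

(* A word records, along the Hamilton cycle, which vertices [x_i] are labelled,
   a label at [x_i] granting the chord [x_(i-1) x_(i+1)]. [stride u] is the number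
   of consecutive vertices, read from the start of [u], that one vertex surely
   dominates; the first letter of [u] plays no role. *)
Definition stride u :=
  if nth false u 1 && nth false u 3 then 5
  else if nth false u 1 || nth false u 2 then 4 else 3.

Fixpoint reach k u :=
  if k is k'.+1 then stride u + reach k' (drop (stride u) u) else 0.

(* Some rotation of the cyclic word [w] is exhausted by [k] greedy strides. The
   lazy [find] replaces [has], which evaluates every rotation. *)
Definition coverable k w :=
  find (fun i => size w <= reach k (rot i w ++ rot i w)) (iota 0 (size w))
    < size w.

(* With these weights a greedy block weighs at least 16, and a word of length [n]
   with [d] more labelled than unlabelled letters weighs [5 n - d]. *)
Definition weight w := 4 * count id w + 6 * count negb w.

(* [walk 1 w] is one more than the labelled excess of [w], and is [0] as soon as
   some nonempty prefix of [w] has a nonpositive excess. *)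
Definition step d x :=
  if d is 0 then 0 else if x then d.+1 else if d < 3 then 0 else d.-1.

Definition walk d w := foldl step d w.

Fixpoint words k : seq (seq bool) :=
  if k is k'.+1 then map (cons true) (words k') ++ map (cons false) (words k')
  else [:: [::]].

Definition tails := flatten (map words (iota 0 4)).

Definition blocks :=
  [seq b <- flatten (map words (iota 3 3)) | stride b == size b].

(** Tabulated by the excess [e], so that the filtering is not repeated at every node of the
    search. *)
Definition below (s : seq (seq bool)) c :=
  [seq [seq b <- s | e + weight b <= c] | e <- iota 0 11].

(* Here [w] is a union of greedy blocks whose weight exceeds 16 per block by
   [e <= 10], [d = walk 1 w] and [m] is [5 * size w] modulo 16. The search tries
   every short end [tl] and every further block [bl] that keeps the excess at most
   10; beyond that the weight alone bounds the number of strides. *)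
Fixpoint explore (tl bl : seq (seq (seq bool))) fuel w e d m :=
  if fuel is f.+1 then
    if all (fun t =>
         let d' := walk d t in
         if d' + (m + 5 * size t) %% 16 < 17 then true else
         if d' is 0 then true else
         let w' := w ++ t in
         if size w' < 7 then true else coverable (5 * size w' %/ 16) w')
       (nth [::] tl e)
    then all (fun b =>
         let d' := walk d b in
         if d' is 0 then true else
         explore tl bl f (w ++ b) (e + weight b - 16) d' ((m + 5 * size b) %% 16))
       (nth [::] bl e)
    else false
  else false.

Lemma exploreT :
  explore (below tails 14) (below blocks 26) 30 [::] 0 1 0 = true.
Proof. by vm_compute. Qed.

(** * Blocks, their weight and soundness of the search *)

Lemma mem_words w : w \in words (size w).
Proof.
elim: w => [|[] w IHw] //=; rewrite mem_cat.
  by rewrite map_f.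
by rewrite orbC map_f.
Qed.

Lemma stride_take u : stride (take (stride u) u) = stride u.
Proof. by case: u => [|a [|[] [|[] [|[] u]]]]; rewrite /stride ?take0. Qed.

Lemma stride_gt2 u : 2 < stride u.
Proof. by rewrite /stride; case: ifP => // _; case: ifP. Qed.

Lemma stride_cat u v : 3 < size u -> stride (u ++ v) = stride u.
Proof. by case: u => [|a [|b [|c [|d u]]]]. Qed.

(** A block of three letters has no label at positions 1 and 2, so a label at position 3, read as
    [false] past its end, cannot lengthen the stride. *)
Lemma stride_block b v : stride b = size b -> stride (b ++ v) = size b.
Proof. by case: b => [|a [|[] [|[] [|[] b]]]]. Qed.

Lemma block_of u : stride u <= size u -> take (stride u) u \in blocks.
Proof.
move=> le_u; rewrite mem_filter stride_take size_takel // eqxx andTb.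
apply/flatten_mapP; exists (stride u).
  by rewrite /stride; case: ifP => // _; case: ifP.
by have := mem_words (take (stride u) u); rewrite size_takel.
Qed.

Lemma weight_cat u v : weight (u ++ v) = weight u + weight v.
Proof. by rewrite /weight !count_cat; lia. Qed.

Lemma weight_cons x u : weight (x :: u) = (if x then 4 else 6) + weight u.
Proof. by case: x; rewrite /weight /=; lia. Qed.

Lemma count_id_negb u : count id u + count negb u = size u.
Proof. by rewrite -(count_predC id u); congr (_ + _); apply: eq_count. Qed.

Lemma weight_size u : weight u + count id u = 5 * size u + count negb u.
Proof. by have := count_id_negb u; rewrite /weight; lia. Qed.

(** A block of three letters has two unlabelled ones, hence weighs at least 4 + 12; longer blocks
    have at least four letters of weight 4. *)
Lemma weight_block u : stride u <= size u -> 16 <= weight (take (stride u) u).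
Proof. by case: u => [|[] [|[] [|[] [|[] [|[] u]]]]]; rewrite /stride //= take0. Qed.

(** Each complete block uses up 16 of the weight, and a remainder lighter than 4 is empty. *)
Lemma weight_leq u k : weight u < 16 * k + 4 -> forall v, size u <= reach k (u ++ v).
Proof.
elim: k u => [|k IHk] u wt_u v /=.
  by case: u wt_u => [|[] u]; rewrite ?weight_cons //; lia.
have [le_u|lt_u] := leqP (size u) (stride (u ++ v)).
  exact: leq_trans le_u (leq_addr _ _).
have gt2 := stride_gt2 (u ++ v); have eq_u := @stride_cat u v (leq_ltn_trans gt2 lt_u).
rewrite eq_u in lt_u *; have wt_b := weight_block (ltnW lt_u).
rewrite drop_cat lt_u -leq_subLR -size_drop; apply: IHk.
have := weight_cat (take (stride u) u) (drop (stride u) u).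
by rewrite cat_take_drop; lia.
Qed.

Lemma reachD k j u : reach (k + j) u = reach k u + reach j (drop (reach k u) u).
Proof.
elim: k u => [|k IHk] u /=; first by rewrite drop0.
by rewrite IHk drop_drop addnA [reach k _ + _]addnC.
Qed.

Lemma mem_tails t : size t < 4 -> t \in tails.
Proof.
move=> lt4; apply/flatten_mapP; exists (size t); last exact: mem_words.
by rewrite mem_iota.
Qed.

Lemma mem_below s c e b : e < 11 -> b \in s -> e + weight b <= c -> b \in nth [::] (below s c) e.
Proof.
move=> lt_e b_s le_c; rewrite (nth_map 0) ?size_iota // nth_iota // mem_filter.
by rewrite b_s le_c.
Qed.

Lemma walk_cat d u v : walk d (u ++ v) = walk (walk d u) v.
Proof. exact: foldl_cat. Qed.

Lemma walk0 u : walk 0 u = 0.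
Proof. by elim: u. Qed.

Lemma walkE d u : walk d u != 0 -> walk d u + count negb u = d + count id u.
Proof.
elim: u d => [|x u IHu] d; first by rewrite /=; lia.
case: d => [|d]; first by rewrite walk0.
rewrite /walk /= -/(walk _ _).
case: x => /=; first by move=> /IHu; lia.
by case: ifP => [|lt_d] => [_|/IHu]; rewrite ?walk0 //; lia.
Qed.

Lemma explore_sound fuel pre e d m k :
  explore (below tails 14) (below blocks 26) fuel pre e d m ->
  e < 11 -> weight pre = 16 * k + e -> d = walk 1 pre ->
  m = (5 * size pre) %% 16 ->
  (forall u, reach k (pre ++ u) = size pre) ->
  forall w u, w = pre ++ u -> walk 1 w != 0 -> 6 < size w ->
  16 * (5 * size w %/ 16).+1 < 5 * size w + walk 1 w ->
  coverable (5 * size w %/ 16) w.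
Proof.
elim: fuel pre e d m k => // f IHf pre e d m k /=.
case: ifP => // tlP blP lt_e wt_pre def_d def_m reach_pre w u def_w.
move=> ballot_w gt6 dense_w; set M := _ %/ 16 in dense_w *.
have szE := weight_size w; have wkE := walkE ballot_w.
have wt_w : weight w = weight pre + weight u by rewrite def_w weight_cat.
have sz_w : size w = size pre + size u by rewrite def_w size_cat.
have M_eq : 16 * M <= 5 * size w < 16 * M.+1 by rewrite /M; lia.
have cov0 : (forall v, size w <= reach M (w ++ v)) -> coverable M w.
  move=> le_w; rewrite /coverable -[in X in _ < X](size_iota 0 (size w)) -has_find.
  apply/hasP; exists 0; rewrite ?mem_iota ?rot0 //; lia.
have leM (j : nat) v : k + j <= M -> size u <= reach j (u ++ v) -> size w <= reach M (w ++ v).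
  move=> /subnKC<- le_u; rewrite -addnA def_w -catA size_cat reachD reach_pre.
  rewrite leq_add2l drop_size_cat // reachD; exact: leq_trans le_u (leq_addr _ _).
have [le_u|lt_u] := leqP (size u) 3.
  (* Density makes [weight w] less than [5 * size w], so [15 <= e + weight u] gives [k < M]: one
     more stride is available. *)
  case: (leqP (e + weight u) 14) => [le14|gt14].
    have /allP/(_ u (mem_below lt_e (mem_tails le_u) le14)) := tlP.
    rewrite {1 2}def_d -!walk_cat -def_w def_m modnDml -mulnDr -sz_w.
    have -> : walk 1 w + (5 * size w) %% 16 < 17 = false by rewrite /M in M_eq dense_w; lia.
    by case: (walk 1 w) ballot_w => // d' _; rewrite ltnNge gt6.
  apply: cov0 => v; apply: (leM 1); first lia.
  rewrite /= addn0; exact: leq_trans le_u (stride_gt2 _).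
(* If the stride overshoots, [u] has exactly four letters and weighs at least 16. *)
have [le_u'|lt_u'] := ltnP (size u) (stride u).
  case: (leqP (e + weight u) 14) => [le14|gt14].
    by have := weight_size u; have := count_size id u; lia.
  apply: cov0 => v; apply: (leM 1); first lia.
  rewrite /= addn0 stride_cat //; exact: ltnW.
have b_in := block_of lt_u'; have wt_b := weight_block lt_u'.
have sz_b := size_takel lt_u'; move: b_in wt_b sz_b.
have def_u := cat_take_drop (stride u) u.
set b := take _ u in def_u *; set u' := drop _ u in def_u => b_in wt_b sz_b.
have wt_u' : weight u = weight b + weight u' by rewrite -def_u weight_cat.
(* Density gives [weight w <= 16 * M + 14]. Beyond 26, what follows [b] thus weighs at most
   [16 * (M - k.+1) + 3], as [weight_leq] requires. *)
have [le26|gt26] := leqP (e + weight b) 26; last first.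
  apply: cov0 => v; apply: (leM (1 + (M - k.+1))); first lia.
  rewrite reachD /= addn0 stride_cat // -sz_b -def_u -catA size_cat leq_add2l.
  rewrite drop_size_cat //; apply: weight_leq; lia.
have /allP/(_ b (mem_below lt_e b_in le26)) := blP.
have ballot_b : walk d b != 0.
  apply: contraNneq ballot_w => eq0.
  by rewrite def_w -def_u catA !walk_cat -def_d eq0 walk0.
have -> : forall T (x y : T), (if walk d b is 0 then x else y) = y.
  by move=> T x y; case: (walk d b) ballot_b.
move=> expl; apply: (IHf _ _ _ _ k.+1 expl _ _ _ _ _ w u') => //.
- by lia.
- by rewrite weight_cat; lia.
- by rewrite walk_cat def_d.
- by rewrite def_m modnDml size_cat mulnDr.
- move=> v; rewrite -addn1 reachD -catA reach_pre drop_size_cat //= addn0.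
  by rewrite size_cat stride_block // sz_b stride_take.
- by rewrite -catA def_u.
Qed.

(* The cycle lemma: cut at the last minimum [j] of the partial excesses, which [h]
   shifts by [size w] to stay in [nat]. *)
Lemma ballot_rot w : count negb w < count id w ->
  exists2 j, j <= size w & walk 1 (rot j w) != 0.
Proof.
move=> lt_w; pose h j := 2 * count id (take j w) + (size w - j).
have h0 : h 0 = size w by rewrite /h take0 subn0.
have hn : h 0 < h (size w).
  by rewrite h0 /h take_size subnn addn0 -(count_id_negb w); lia.
have h_walk u : (forall j, 0 < j <= size u -> j < 2 * count id (take j u)) -> walk 1 u != 0.
  elim/last_ind: u => [//|u x IHu] pos_u.
  have/IHu ballot_u j : 0 < j <= size u -> j < 2 * count id (take j u).
    move=> /andP[j_gt0 le_j]; have := pos_u j; rewrite size_rcons j_gt0 leqW // => /(_ isT).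
    by rewrite -cats1 takel_cat.
  have := pos_u (size u).+1; rewrite size_rcons leqnn take_oversize ?size_rcons // => /(_ isT).
  move: pos_u => _; have := walkE ballot_u; have := count_id_negb u.
  rewrite -cats1 count_cat walk_cat /walk /= addn0 -/(walk 1 u).
  case: (walk 1 u) ballot_u => // d _; case: x => //= ; rewrite /step.
  by case: (ltnP d.+1 3); lia.
pose P j := (j <= size w) && [forall i : 'I_(size w).+1, h j <= h i].
have exP : exists j, P j.
  case: (@arg_minnP _ (@ord0 (size w)) predT h isT) => j _ min_j; exists j.
  by rewrite /P -ltnS ltn_ord; apply/forallP=> i; apply: min_j.
have leP j : P j -> j <= size w by case/andP.
case: (ex_maxnP exP leP) => j /andP[le_j /forallP min_j] max_j.
have {}min_j i : i <= size w -> h j <= h i.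
  by rewrite -ltnS => lt_i; apply: (min_j (Ordinal lt_i)).
have lt_min i : j < i <= size w -> h j < h i.
  case/andP=> lt_ji le_i; rewrite ltn_neqAle min_j // andbT.
  apply: contraL lt_ji => /eqP eq_h; rewrite -leqNgt; apply: max_j.
  rewrite /P le_i; apply/forallP=> i'; rewrite -eq_h; apply: min_j.
  by rewrite -ltnS.
exists j => //; apply: h_walk => i; rewrite size_rot => /andP[i_gt0 le_i].
have cntE : count id (take j w) + count id (drop j w) = count id w.
  by rewrite -count_cat cat_take_drop.
have [le_ij|lt_ij] := leqP (j + i) (size w).
  have := lt_min (j + i); rewrite le_ij -addn1 leq_add2l i_gt0 => /(_ isT).
  rewrite /h /rot takel_cat ?size_drop; last lia.
  by rewrite takeD count_cat; lia.
(* The prefix wraps around: it gains the total excess, positive by [hn], so weak minimality of [j]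
   suffices. *)
have := min_j (j + i - size w); have := min_j 0 isT.
move: hn; rewrite {2}/h take_size subnn => hn hj0 /(_ ltac:(lia)).
rewrite /rot take_cat size_drop ifN; last lia.
rewrite count_cat take_takel; last lia.
have -> : i - (size w - j) = j + i - size w by lia.
by move: hn hj0; rewrite h0 /h; lia.
Qed.

(* If [M = 5 n %/ 16] and the labelled excess is [d], this is [16 (M + 1) <= 5 n + d]. *)
Definition dense w := 16 * (5 * size w %/ 16).+1 <= 6 * count id w + 4 * count negb w.

Lemma dense_coverable w : 6 < size w -> dense w -> walk 1 w != 0 -> coverable (5 * size w %/ 16) w.
Proof.
move=> gt6 dense_w ballot_w.
apply: (explore_sound (k := 0) exploreT _ _ _ _ _ (erefl ([::] ++ w))) => //.
have := weight_size w; have := walkE ballot_w; move: dense_w.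
by rewrite /dense /weight cat0s; lia.
Qed.

End Words.

(** * Domination along the cycle *)

Section Coverage.

Variables (V : finType) (G : sgraph V) (s : V -> V) (lab : pred V).
Hypothesis adj_s : forall v, G v (s v).
Hypothesis adj_lab : forall v, lab (s v) -> G v (s (s v)).

Definition dominated (D : {set V}) v := (v \in D) || [exists u in D, G u v].

Lemma dominatedS (D E : {set V}) v : D \subset E -> dominated D v -> dominated E v.
Proof.
move=> /subsetP sDE /orP[/sDE|/exists_inP[u /sDE uE uv]]; rewrite /dominated.
  by move=> ->.
by apply/orP; right; apply/exists_inP; exists u.
Qed.

Lemma dominated1 c v : (v == c) || G c v -> dominated [set c] v.
Proof.
case/orP=> [/eqP->|cv]; rewrite /dominated ?inE ?eqxx //.
by apply/orP; right; apply/exists_inP; exists c; rewrite ?inE.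
Qed.

(** The centre is the third vertex if position 1 is labelled, which adds the first vertex, and the
    fifth if position 3 is labelled too. Otherwise it is the second vertex, reaching the fourth if
    position 2 is labelled. *)
Lemma stride_dominated u v :
  (forall i, nth false u i -> lab (iter i s v)) ->
  exists c, forall i, i < stride u -> dominated [set c] (iter i s v).
Proof.
move=> lab_u.
have adjV x : G (s x) x by rewrite adj_sym.
have adj2 i : nth false u i.+1 -> G (iter i s v) (iter i.+2 s v).
  by move/lab_u/adj_lab.
rewrite /stride; case: ifP => [/andP[u1 u3]|_].
  exists (iter 2 s v) => -[|[|[|[|[|i]]]]] // _; apply: dominated1; rewrite ?eqxx //.
  - by rewrite [G _ _]adj_sym adj2 ?orbT.
  - by rewrite adjV orbT.
  - by rewrite adj_s orbT.
  - by rewrite adj2 ?orbT.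
case: ifP => [/orP[u1|u2]|_].
- exists (iter 2 s v) => -[|[|[|[|i]]]] // _; apply: dominated1; rewrite ?eqxx //.
  + by rewrite [G _ _]adj_sym adj2 ?orbT.
  + by rewrite adjV orbT.
  + by rewrite adj_s orbT.
- exists (iter 1 s v) => -[|[|[|[|i]]]] // _; apply: dominated1; rewrite ?eqxx //.
  + by rewrite adjV orbT.
  + by rewrite adj_s orbT.
  + by rewrite adj2 ?orbT.
exists (iter 1 s v) => -[|[|[|i]]] // _; apply: dominated1; rewrite ?eqxx //.
+ by rewrite adjV orbT.
+ by rewrite adj_s orbT.
Qed.

Lemma reach_dominated k u v :
  (forall i, nth false u i -> lab (iter i s v)) ->
  exists2 D : {set V}, #|D| <= k &
    forall i, i < reach k u -> dominated D (iter i s v).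
Proof.
elim: k u v => [|k IHk] u v lab_u; first by exists set0; rewrite ?cards0.
have [c dom_c] := stride_dominated lab_u.
have [|D le_k dom_D] := IHk (drop (stride u) u) (iter (stride u) s v).
  by move=> i; rewrite nth_drop -iterD addnC; apply: lab_u.
exists (c |: D); first by rewrite cardsU1; case: (c \notin D) => /=; lia.
move=> i /= lt_i; have [lt_is|le_si] := ltnP i (stride u).
  exact/(dominatedS _ (dom_c i lt_is))/subsetUl.
rewrite -(subnK le_si) iterD; apply/(dominatedS (subsetUr _ _))/dom_D.
by rewrite ltn_subLR.
Qed.

Variable H : seq V.
Hypothesis H_uniq : uniq H.
Hypothesis H_mem : forall v, v \in H.
Hypothesis s_next : next H =1 s.

Lemma rot_traject j : 0 < size H ->
  exists2 v, rot j H = traject s v (size H) & iter (size H) s v = v.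
Proof.
rewrite -(size_rot j) => H_gt0; have uniq_r : uniq (rot j H) by rewrite rot_uniq.
have := cycle_next uniq_r; rewrite (eq_cycle (e' := frel s)); last first.
  by move=> x y /=; rewrite next_rot // s_next.
case: (rot j H) H_gt0 => [|v r] //= _; rewrite rcons_path => /andP[/fpathP[k ->] /eqP].
rewrite last_traject size_traject => sv; exists v => //.
Qed.

Lemma coverable_dominated k : 0 < size H -> coverable k (map lab H) ->
  exists2 D : {set V}, #|D| <= k & forall v, dominated D v.
Proof.
move=> H_gt0; rewrite /coverable -[in X in _ < X](size_iota 0 (size _)) -has_find.
case/hasP=> i _; rewrite -map_rot; have [v def_r itv] := rot_traject i H_gt0.
set u := _ ++ _; rewrite size_map => le_n.
have [|D leD domD] := @reach_dominated k u v.
  move=> j; rewrite /u nth_cat size_map size_rot def_r; case: ltnP => [lt_j|le_j].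
    by rewrite (nth_map v) ?size_traject // nth_traject.
  case: (ltnP (j - size H) (size H)) => [lt_j|le_j']; last first.
    by rewrite nth_default // size_map size_traject.
  rewrite (nth_map v) ?size_traject // nth_traject //.
  by rewrite -{2}(subnK le_j) iterD itv.
exists D => // x; have := H_mem x; rewrite -(mem_rot i) def_r => /trajectP[j lt_j ->].
exact/domD/(leq_trans lt_j).
Qed.

End Coverage.

Lemma dense_dominated (V : finType) (G : sgraph V) (s : V -> V) (lab : pred V) H :
    (forall v, G v (s v)) -> (forall v, lab (s v) -> G v (s (s v))) ->
    uniq H -> (forall v, v \in H) -> next H =1 s -> 6 < size H ->
    dense (map lab H) ->
  exists2 D : {set V}, #|D| <= 5 * size H %/ 16 & forall v, dominated G D v.
Proof.
move=> adj_s adj_lab H_uniq H_mem H_next gt6 dense_H; set w := map lab H.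
have szw : size w = size H by rewrite size_map.
have cntw := count_id_negb w.
have [|j le_j ballot_j] := @ballot_rot w.
  by move: dense_H; rewrite /dense -/w szw; lia.
have := @coverable_dominated V G s lab adj_s adj_lab (rot j H).
have -> : 5 * size H %/ 16 = 5 * size (rot j w) %/ 16 by rewrite size_rot szw.
apply.
- by rewrite rot_uniq.
- by move=> v; rewrite mem_rot.
- by move=> v; rewrite next_rot.
- by rewrite size_rot; apply: leq_trans gt6.
rewrite map_rot; apply: dense_coverable; rewrite ?size_rot ?szw //.
have cnt_rot a : count a (rot j w) = count a w.
  by rewrite /rot count_cat addnC -count_cat cat_take_drop.
by rewrite /dense !cnt_rot size_rot.
Qed.

(** * The two sides of the Hamilton cycle *)

(* Colours form the Klein four-group, where the colour missing from three distinct
   ones is their sum. *)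
Definition fourth (a b c : bool * bool) : bool * bool :=
  (a.1 (+) b.1 (+) c.1, a.2 (+) b.2 (+) c.2).

Lemma fourthP (a b c : bool * bool) : a != b -> b != c -> a != c ->
  [/\ fourth a b c != a, fourth a b c != b & fourth a b c != c].
Proof. by move: a b c => [[] []] [[] []] [[] []]. Qed.

Lemma four_colours (a b c d k : bool * bool) :
    a != b -> a != c -> a != d -> b != c -> b != d -> c != d ->
  [|| k == a, k == b, k == c | k == d].
Proof. by move: a b c d k => [[] []] [[] []] [[] []] [[] []] [[] []]. Qed.

(* Cardinals of dart sets may carry different [reverse_coercion] casts, which
   [lia] would treat as distinct atoms. *)
Ltac card_lia := unfold reverse_coercion in *; lia.

Section Sides.

Variables (V : finType) (G : sgraph V) (rot : V -> {perm V}) (s p : V -> V).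
Hypothesis rotG : rotation_system G rot.
Hypothesis order3 : forall d, d \in darts G -> order (face_step rot) d = 3.
Hypothesis sK : cancel s p.
Hypothesis pK : cancel p s.
Hypothesis adj_s : forall v, G v (s v).
Hypothesis s_neq_p : forall v, s v != p v.
Hypothesis s_conn : forall u v, fconnect s u v.

Local Notation phi := (face_step rot).
Implicit Types (d : V * V) (X Y : {set V * V}).

Definition flip d := (d.2, d.1).

Definition chord d := (d.2 != s d.1) && (d.2 != p d.1).

Lemma chord_flip d : chord (flip d) = chord d.
Proof.
by rewrite /chord /= -(can2_eq pK sK) -(can2_eq sK pK) andbC ![_ d.1 == _]eq_sym.
Qed.

Lemma flip_darts d : (flip d \in darts G) = (d \in darts G).
Proof. by rewrite !inE adj_sym. Qed.

Lemma adj_rot u v : G v u -> G v (rot v u).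
Proof. by have := perm_closed u (rotG v).1; rewrite !inE => ->. Qed.

Lemma phi3 d : d \in darts G -> phi (phi (phi d)) = d.
Proof. by move/order3=> ord_d; have := iter_order (@face_step_inj V rot) d; rewrite ord_d. Qed.

Lemma rot_face u v : G u v -> rot (rot v u) v = u.
Proof.
move=> uv; have := @phi3 (u, v); rewrite inE => /(_ uv).
by case.
Qed.

Definition face d := [set d; phi d; phi (phi d)].

Definition links X := [set d in X | chord d && (flip d \in X)].

Definition corners X := [set d.1 | d in X].

Definition good_colouring (c : V -> bool * bool) X :=
  (forall d, d \in X -> c d.1 != c d.2) /\
  (forall d, d \in links X -> c (rot d.2 d.1) != c (rot d.1 d.2)).

(* Every face glued across a chord adds two darts to [links X], three to [X] and at
   most one vertex. If the last bound is attained, then each gluing brings a new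
   vertex and no other chord, so the colouring extends. *)
Definition treelike X :=
  [/\ X \subset darts G /\ (forall d, d \in X -> phi d \in X),
      2 * #|X| <= 3 * #|links X| + 6,
      2 * #|corners X| <= #|links X| + 6 &
      2 * #|corners X| = #|links X| + 6 -> exists c, good_colouring c X].

Definition chord_closed X :=
  [/\ X \subset darts G, forall d, d \in X -> phi d \in X &
      forall d, d \in X -> chord d -> flip d \in X].

Lemma mem_links d X : (d \in links X) = [&& d \in X, chord d & flip d \in X].
Proof. by rewrite inE. Qed.

(** * Gluing faces across chords *)

Lemma flipK : involutive flip.
Proof. by case. Qed.

Lemma mem_corners d X : d \in X -> d.1 \in corners X.
Proof. exact: imset_f. Qed.

Lemma mem_corners2 d X : (forall d, d \in X -> phi d \in X) -> d \in X -> d.2 \in corners X.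
Proof. by move=> phiX dX; apply: (mem_corners (phiX d dX)). Qed.

Lemma face_closed d e : d \in darts G -> e \in face d -> phi e \in face d.
Proof.
by move=> dG; rewrite !inE => /orP[/orP[]|] /eqP->; rewrite ?phi3 ?eqxx ?orbT.
Qed.

Lemma face_sub d : d \in darts G -> face d \subset darts G.
Proof.
move=> dG; apply/subsetP=> e; rewrite in_setU in_set1 in_set2.
by case/orP=> [/orP[]|] /eqP->; rewrite ?face_step_darts.
Qed.

Lemma card_face d : #|face d| <= 3.
Proof.
by rewrite /face (leq_trans (leq_card_setU _ _)) // cards2 cards1; case: eqP.
Qed.

Lemma treelike_face d : d \in darts G -> treelike (face d).
Proof.
move=> dG; have phiF e := @face_closed d e dG.
have cornersE : corners (face d) = [set d.1; d.2; rot d.2 d.1].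
  by rewrite /corners /face !imsetU !imset_set1.
have le3 : #|corners (face d)| <= 3.
  rewrite cornersE (leq_trans (leq_card_setU _ _)) // cards2 cards1; by case: eqP.
split; first by split=> //; apply: face_sub.
- by have := card_face d; card_lia.
- by card_lia.
move=> eq_card; have links0 : links (face d) = set0.
  by apply/eqP; rewrite -cards_eq0; card_lia.
have : #|corners (face d)| = 3 by card_lia.
rewrite cornersE; set x := d.1; set y := d.2; set z := rot _ _ => card3.
have [nxy nxz nyz] : [/\ x != y, x != z & y != z].
  move: card3; rewrite -setUA !cardsU1 cards1 !inE.
  by do 3 case: eqP => //=.
exists (fun v => (v == x, v == y)); split=> [e|e]; last by rewrite links0 inE.
have eqs := (eqxx, negbTE nxy, negbTE nxz, negbTE nyz).
have eqs' : (y == x = false) * (z == x = false) * (z == y = false).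
  by rewrite ![_ == x]eq_sym [z == y]eq_sym !eqs.
rewrite !inE => /orP[/orP[]|] /eqP-> /=; rewrite -/x -/y -/z.
- by rewrite !eqs !eqs'.
- by rewrite !eqs !eqs'.
have -> : rot z y = x by apply: rot_face; move: dG; rewrite inE.
by rewrite !eqs !eqs'.
Qed.

Lemma dart_neq d : d \in darts G -> d.1 != d.2.
Proof. by rewrite inE; apply: contraTneq => ->; rewrite adj_irr. Qed.

Lemma treelike_glue X d : treelike X -> d \in X -> chord d -> flip d \notin X ->
  treelike (X :|: face (flip d)).
Proof.
case=> [[XG phiX] leX leC colX] dX chd rdX.
have dG := subsetP XG d dX; have rdG : flip d \in darts G by rewrite flip_darts.
set Y := X :|: _; set b := rot d.1 d.2; set a := rot d.2 d.1.
have phiY e : e \in Y -> phi e \in Y.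
  rewrite /Y 2!(in_setU _ X) => /orP[/phiX->|] //.
  by move=> eF; rewrite (face_closed rdG eF) orbT.
have sXY : X \subset Y := subsetUl _ _.
have rdY : flip d \in Y by rewrite !inE eqxx orbT.
have new_links : [set d; flip d] :|: links X \subset links Y.
  apply/subsetP=> e; rewrite in_setU in_set2 !mem_links.
  case/orP=> [/orP[]/eqP->|/and3P[eX -> reX]].
  - by rewrite (subsetP sXY) // chd.
  - by rewrite chord_flip chd flipK rdY (subsetP sXY).
  - by rewrite !(subsetP sXY).
have d_rev : d != flip d.
  by apply: contra (dart_neq dG) => /eqP/(congr1 fst)/= ->.
have card_links : #|[set d; flip d] :|: links X| = #|links X| + 2.
  rewrite -setUA !cardsU1 !inE (negbTE d_rev) !(negbTE rdX) /= andbF /=.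
  by card_lia.
have [cd1 cd2] := (mem_corners dX, mem_corners2 phiX dX).
have sub_corners : corners Y \subset b |: corners X.
  rewrite /corners /face !imsetU !imset_set1 /= -/b subUset subsetUr /=.
  by rewrite !subUset !sub1set !inE cd1 cd2 eqxx ?orbT.
have le_links := subset_leq_card new_links.
have le_corners := subset_leq_card sub_corners.
have le_Y : #|Y| <= #|X| + 3.
  by rewrite (leq_trans (leq_card_setU _ _)) // leq_add2l card_face.
rewrite cardsU1 in le_corners; rewrite card_links in le_links.
split; first by rewrite subUset XG face_sub.
- by move: leX le_links le_Y; clearbody Y; clear; card_lia.
- by move: leC le_links le_corners; case: (b \notin _); clearbody Y; clear; card_lia.
(* Equality for [Y] makes every estimate tight: [X] attains its bound, [b] is a new corner, and [d]
   and [flip d] are the only new links. *)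
move=> eq_Y; have {}/colX [c [edge_c link_c]] : 2 * #|corners X| = #|links X| + 6.
  by move: eq_Y leC le_links le_corners; case: (b \notin _); clearbody Y; clear; card_lia.
have b_new : b \notin corners X
  by apply: contraTN isT => bX; move: eq_Y leC le_links le_corners; rewrite bX;
    clearbody Y; clear; card_lia.
have links_eq : links Y = [set d; flip d] :|: links X.
  by apply/esym/eqP; rewrite eqEcard new_links card_links; move: eq_Y leC le_corners;
    case: (b \notin _); clearbody Y; clear; card_lia.
have ab : G d.2 d.1 by rewrite inE in rdG.
have phi_d : phi d = (d.2, a) by [].
have aX : a \in corners X by rewrite -[a]/(phi d).2 mem_corners2 // phiX.
have c12 := edge_c d dX.
have c2a : c d.2 != c a by apply: (edge_c (d.2, a)); rewrite -phi_d phiX.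
have c1a : c d.1 != c a.
  have := edge_c _ (phiX _ (phiX _ dX)); rewrite /= rot_face 1?eq_sym //.
  by rewrite adj_sym.
have [f1 f2 fa] := fourthP c12 c2a c1a.
(* The new corner must differ from both ends of the chord and from the opposite corner [a]. *)
pose c' v := if v == b then fourth (c d.1) (c d.2) (c a) else c v.
have c'X v : v \in corners X -> c' v = c v.
  by rewrite /c'; case: eqP => // ->; rewrite (negbTE b_new).
have c'b : c' b = fourth (c d.1) (c d.2) (c a) by rewrite /c' eqxx.
exists c'; split=> e.
  rewrite !inE => /orP[eX|/orP[/orP[]|] /eqP->] /=; rewrite -/b ?rot_face //.
  - by rewrite !c'X ?edge_c // (mem_corners, mem_corners2).
  - by rewrite !c'X // eq_sym.
  - by rewrite c'b c'X // eq_sym.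
  - by rewrite c'b c'X.
rewrite links_eq in_setU in_set2 => /orP[/orP[] /eqP->|eL] /=; rewrite -/a -/b.
- by rewrite c'b c'X // eq_sym.
- by rewrite c'b c'X.
have [eX _ reX] : [/\ e \in X, chord e & flip e \in X] by apply/and3P; rewrite inE in eL.
rewrite !c'X; first exact: link_c.
- by rewrite -[rot _ _]/(phi (flip e)).2 mem_corners2 // phiX.
- by rewrite -[rot _ _]/(phi e).2 mem_corners2 // phiX.
Qed.

Lemma treelike_closure X : treelike X ->
  exists Y, [/\ X \subset Y, treelike Y & chord_closed Y].
Proof.
have [k] := ubnP #|~: X|; elim: k X => // k IHk X /ltnSE-le_k treeX.
have [/exists_inP[d dX /andP[chd rdX]]|noX] := boolP [exists d in X, chord d && (flip d \notin X)].
  have [|Y [sXY treeY closedY]] := IHk _ _ (treelike_glue treeX dX chd rdX).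
    apply: leq_trans le_k; apply: proper_card; rewrite setCU; apply/properP.
    split; first exact: subsetIl.
    by exists (flip d); rewrite !inE ?eqxx //= ?andbF //; move: rdX.
  by exists Y; split=> //; apply: subset_trans sXY; apply: subsetUl.
exists X; split=> //; case: treeX => -[XG phiX] _ _ _; split=> // d dX chd.
by apply: contraNT noX => rdX; apply/exists_inP; exists d => //; rewrite chd.
Qed.

(** Cross the chord and follow the face beyond it: rotating about [w] stays in [Y] until an edge of
    the cycle is met. *)
Lemma turn_step Y w x : chord_closed Y -> (w, x) \in Y -> x != s w -> x != p w ->
  (w, rot w x) \in Y.
Proof.
case=> _ phiY chY wxY xs xp; apply: (phiY (x, w)).
by apply: (chY (w, x)) => //; rewrite /chord xs.
Qed.

Lemma turn_face Y d : chord_closed Y -> d \in Y -> (d.2, rot d.2 d.1) \in Y.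
Proof. by case=> _ phiY _ /phiY. Qed.

Lemma rot_orbit w x y : G w x -> G w y -> exists i, y = iter i (rot w) x.
Proof.
move=> wx wy; have := (rotG w).2 x y; rewrite !inE wx wy => /(_ isT isT).
by case/porbitP=> i ->; exists i; rewrite permX.
Qed.

Lemma closed_turn Y d : chord_closed Y -> d \in Y ->
  (d.1, s d.1) \in Y \/ (d.1, p d.1) \in Y.
Proof.
case: d => w x clY /= wxY.
have wx : G w x by case: clY => /subsetP/(_ _ wxY); rewrite inE.
have [i] := rot_orbit wx (adj_s w); elim: i x wxY {wx} => [|i IHi] x wxY def_s.
  by left; rewrite def_s.
have [xs|xs] := eqVneq x (s w); first by left; rewrite -xs.
have [xp|xp] := eqVneq x (p w); first by right; rewrite -xp.
by apply: IHi (turn_step clY wxY xs xp) _; rewrite -iterSr.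
Qed.

(* Turning at [s v] from the dart coming from [v], the first dart of the Hamilton
   cycle that is met is the outgoing one. *)
Lemma closed_succ Y v : chord_closed Y -> (v, s v) \in Y -> (s v, s (s v)) \in Y.
Proof.
move=> clY vY; set w := s v; have pw : p w = v by rewrite /w sK.
have wv : G w v by rewrite adj_sym adj_s.
have exi : exists i, s w == iter i (rot w) v.
  by have [i ->] := rot_orbit wv (adj_s w); exists i.
case: (ex_minnP exi) => i /eqP def_i min_i.
have i_gt0 : 0 < i.
  by case: i def_i {min_i} => //= def_v; have := s_neq_p w; rewrite pw def_v eqxx.
have inY j : 0 < j <= i -> (w, iter j (rot w) v) \in Y.
  elim: j => // -[_ _|j IHj /= lt_j]; first exact: (turn_face clY vY).
  apply: turn_step => //; first by apply: IHj; apply: ltnW.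
    apply/eqP=> eq_s; have := min_i j.+1; rewrite /= eq_s eqxx => /(_ isT).
    by rewrite leqNgt lt_j.
  (* A return to [v] after [j.+1] turns would let [s w] be met that many turns earlier. *)
  rewrite pw; apply/eqP=> eq_v; have := min_i (i - j.+1).
  rewrite def_i -{1}(subnK (ltnW lt_j)) iterD /= eq_v eqxx => /(_ isT).
  by card_lia.
by rewrite def_i; apply: inY; rewrite i_gt0 leqnn.
Qed.

Lemma closed_all_succ Y u v : chord_closed Y -> (u, s u) \in Y -> (v, s v) \in Y.
Proof.
move=> clY uY; have /iter_findex <- := s_conn u v.
by elim: (findex _ _ _) => //= i; apply: closed_succ.
Qed.

Lemma closedI X Y : chord_closed X -> chord_closed Y -> chord_closed (X :&: Y).
Proof.
case=> XG phiX chX [_ phiY chY]; split=> [|d|d].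
- by rewrite subIset ?XG.
- by rewrite !in_setI => /andP[/phiX-> /phiY].
- by rewrite !in_setI => /andP[dX dY] chd; rewrite chX ?chY.
Qed.

Lemma closedC Y : chord_closed Y -> chord_closed (darts G :\: Y).
Proof.
case=> YG phiY chY; split=> [|d|d]; first exact: subsetDl.
- rewrite !in_setD face_step_darts // => /andP[dY dG]; rewrite dG andbT.
  by apply: contra dY => /phiY/phiY; rewrite phi3.
- rewrite !in_setD flip_darts => /andP[dY ->] chd; rewrite andbT.
  by apply: contra dY => /chY; rewrite chord_flip flipK => /(_ chd).
Qed.

(** * Counting chords and separating the sides *)

Definition succ_darts := [set (v, s v) | v : V].
Definition pred_darts := [set (v, p v) | v : V].

Lemma card_succ_darts : #|succ_darts| = #|V|.
Proof. by rewrite card_imset // => u v []. Qed.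

Lemma card_pred_darts : #|pred_darts| = #|V|.
Proof. by rewrite card_imset // => u v []. Qed.

Lemma links_sub X : X \subset darts G ->
  links X \subset darts G :\: (succ_darts :|: pred_darts).
Proof.
move=> XG; apply/subsetP=> d; rewrite in_setD in_setU inE => /and3P[dX /andP[ds dp] _].
rewrite (subsetP XG) // andbT negb_or; apply/andP; split.
  by apply: contraNN ds => /imsetP[v _ ->].
by apply: contraNN dp => /imsetP[v _ ->].
Qed.

Lemma adj_p v : G v (p v).
Proof. by rewrite adj_sym -{2}[v]pK adj_s. Qed.

Lemma card_chords : #|darts G :\: (succ_darts :|: pred_darts)| + 2 * #|V| = #|darts G|.
Proof.
have sub : succ_darts :|: pred_darts \subset darts G.
  rewrite subUset; apply/andP; split; apply/subsetP=> d /imsetP[v _ ->]; rewrite inE ?adj_s //.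
  exact: adj_p.
have disj : succ_darts :&: pred_darts = set0.
  apply/setP=> d; rewrite !inE; apply/negP=> /andP[/imsetP[v _ ->] /imsetP[u _ [<-]]].
  by apply/eqP/s_neq_p.
rewrite -(cardsID (succ_darts :|: pred_darts) (darts G)) addnC (setIidPr sub).
by rewrite cardsU disj cards0 card_succ_darts card_pred_darts; card_lia.
Qed.

Hypothesis card_darts : #|darts G| + 12 = 6 * #|V|.

(* The set [X] consists of the darts of the faces on one side of the cycle. *)
Definition side X :=
  [/\ chord_closed X, treelike X, forall v, (v, s v) \in X & forall v, (v, p v) \notin X].

(* If [X] met the other side it would contain all darts, but then the first bound of
   [treelike] contradicts Euler's formula. *)
Lemma exists_side (v0 : V) :
  (forall Y u v, chord_closed Y -> (u, p u) \in Y -> (v, p v) \in Y) ->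
  exists X, side X.
Proof.
move=> closed_all_pred; have d0G : (v0, s v0) \in darts G by rewrite inE adj_s.
have [X [/subsetP sX treeX clX]] := treelike_closure (treelike_face d0G).
have sX0 : (v0, s v0) \in X by apply: sX; rewrite !inE eqxx.
have succX v := closed_all_succ v clX sX0.
exists X; split=> // v; apply/negP=> pX.
have predX u := closed_all_pred X v u clX pX.
case: treeX => -[XG _] leX _ _.
(* The complement of [X] is closed too, so a dart in it would yield a dart of the cycle outside
   [X]. *)
have GX : darts G \subset X.
  rewrite -setD_eq0; apply/eqP/setP=> d; rewrite in_set0; apply/negP=> dX.
  by have [] := closed_turn (closedC clX) dX; rewrite in_setD ?succX ?predX.
(* There are 6n - 12 darts and 4n - 12 chord darts, but 2 (6n - 12) exceeds 3 (4n - 12) + 6. *)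
have := subset_leq_card (links_sub XG); have := subset_leq_card GX.
by have := card_chords; card_lia.
Qed.

(** * Four dominating sets from one side *)

Lemma sum_fibres (T I : finType) (A : {set T}) (f : T -> I) :
  \sum_k #|[set x in A | f x == k]| = #|A|.
Proof.
rewrite -sum1_card (partition_big f predT) //=; apply: eq_bigr => k _.
by rewrite -sum1_card; apply: eq_bigl => x; rewrite inE.
Qed.

Lemma dominating_dominated D : (forall v, dominated G D v) -> dominating G D.
Proof. by move=> domD; apply/forallP. Qed.

(* The vertices incident with no chord on the side of the darts [(v, s v)]. *)
Definition side_ears := [set w | rot w (p w) == s w].

Lemma ear_adj w : w \in side_ears -> G (p w) (s w).
Proof.
rewrite inE => /eqP def_s; have pw : G (p w) w by rewrite adj_sym adj_p.
by rewrite adj_sym -(rot_face pw) def_s adj_rot // adj_sym adj_s.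
Qed.

Lemma side_corners X : side X -> corners X = setT.
Proof. by case=> _ _ succX _; apply/setP=> v; rewrite inE; apply: (mem_corners (succX v)). Qed.

Lemma side_links X : side X -> 2 * #|V| <= #|links X| + 6.
Proof. by move=> sideX; case: (sideX) => _ [_ _]; rewrite side_corners // cardsT. Qed.

Lemma side_domination X : side X -> 2 * #|V| = #|links X| + 6 ->
  4 * domination_number G <= #|V| + #|side_ears|.
Proof.
move=> sideX card_links; case: (sideX) => clX [_ _ _ colX] succX predX.
have [XG phiX chX] := clX.
have [|c [edge_c link_c]] := colX; first by rewrite side_corners // cardsT.
have predX' w : (p w, w) \in X by rewrite -{2}[w]pK.
pose missing w := fourth (c w) (c (p w)) (c (s w)).
pose D k := [set v in [set: V] | c v == k] :|: [set w in side_ears | missing w == k].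
have domD k : dominating G (D k).
  apply: dominating_dominated => w; rewrite /dominated !inE /=.
  have via u : G u w -> k == c u -> [exists u in D k, G u w].
    by move=> uw /eqP def_k; apply/exists_inP; exists u; rewrite // !inE -def_k eqxx.
  have [/eqP ear|not_ear] := boolP (rot w (p w) == s w).
    have c1 : c w != c (p w) by rewrite eq_sym (edge_c (p w, w)).
    have c2 : c w != c (s w) by rewrite (edge_c (w, s w)).
    have c3 : c (p w) != c (s w).
      have := edge_c _ (phiX _ (phiX _ (predX' w))); rewrite /= rot_face ?ear 1?eq_sym //.
      by rewrite adj_sym adj_p.
    have [f1 f2 f3] := fourthP c1 c3 c2.
    have := @four_colours _ _ _ (missing w) k c1 c2 _ c3 _ _.
    rewrite ![_ == missing w]eq_sym => /(_ f1 f2 f3) /or4P[kc|kc|kc|kc].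
    - by rewrite eq_sym kc.
    - by rewrite (via (p w)) ?orbT // adj_sym adj_p.
    - by rewrite (via (s w)) ?orbT // adj_sym.
    - by rewrite kc orbT.
  (* The next neighbour [x] spans a chord with [w]; the two faces along it show all four colours on
     [w], [x], [a], [b]. *)
  set x := rot w (p w) in not_ear.
  have wxX : (w, x) \in X by apply: (phiX _ (predX' w)).
  have xp : x != p w by apply: contraNneq (predX w) => <-.
  have chd : chord (w, x) by rewrite /chord not_ear.
  have xwX : (x, w) \in X by apply: (chX (w, x)).
  have wx : G w x by have := subsetP XG _ wxX; rewrite inE.
  have xw : G x w by rewrite adj_sym.
  set a := rot x w; set b := rot w x.
  have xa : G x a by apply: adj_rot.
  have wb : G w b by apply: adj_rot.
  have waX := phiX _ (phiX _ wxX); have xbX := phiX _ (phiX _ xwX).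
  rewrite /face_step /= rot_face // in waX; rewrite /face_step /= rot_face // in xbX.
  have aw : G a w by have := subsetP XG _ waX; rewrite inE.
  have cab : c a != c b by apply: (link_c (w, x)); rewrite inE wxX chd.
  have c1 : c w != c x by apply: (edge_c (w, x)).
  have c2 : c w != c a by rewrite eq_sym; apply: (edge_c (a, w)).
  have c3 : c w != c b by apply: (edge_c _ (phiX _ xwX)).
  have c4 : c x != c a by apply: (edge_c _ (phiX _ wxX)).
  have c5 : c x != c b by rewrite eq_sym; apply: (edge_c (b, x)).
  have /or4P[kc|kc|kc|kc] := four_colours k c1 c2 c3 c4 c5 cab.
  - by rewrite eq_sym kc.
  - by rewrite (via x) ?orbT.
  - by rewrite (via a) ?orbT.
  - by rewrite (via b) ?orbT // adj_sym.
have [_ minD] := domination_number_min G.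
have <- : \sum_(k : bool * bool) domination_number G = 4 * domination_number G.
  by rewrite sum_nat_const card_prod card_bool.
have <- : \sum_(k : bool * bool)
    (#|[set v in [set: V] | c v == k]| + #|[set w in side_ears | missing w == k]|)
    = #|V| + #|side_ears|.
  by rewrite big_split /= !sum_fibres cardsT.
apply: leq_sum => k _; apply: leq_trans (minD _ (domD k)) _.
exact: leq_card_setU.
Qed.

End Sides.

(** * Counting *)

Section Swap.

Variables (V : finType) (G : sgraph V) (rot : V -> {perm V}) (s p : V -> V).
Implicit Types (X : {set V * V}).

(** Reversing the cycle keeps its chords and exchanges its sides, so one side's results serve for
    both. *)
Lemma chord_swap d : chord p s d = chord s p d.
Proof. exact: andbC. Qed.

Lemma links_swap X : links p s X = links s p X.
Proof. by apply/setP=> d; rewrite !inE chord_swap. Qed.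

Lemma closed_swap X : chord_closed G rot p s X -> chord_closed G rot s p X.
Proof. by case=> XG phiX chX; split=> // d dX; rewrite -chord_swap; apply: chX. Qed.

End Swap.

Lemma leq_min_degree (V : finType) (G : sgraph V) v : min_degree G <= degree G v.
Proof.
rewrite /min_degree; have : v \in index_enum V by apply: mem_index_enum.
elim: (index_enum V) => // u r IHr; rewrite inE big_cons geq_min.
by case/orP=> [/eqP->|/IHr->]; rewrite ?leqnn ?orbT.
Qed.

Lemma card_darts_edges (V : finType) (G : sgraph V) : #|darts G| = 2 * #|edges G|.
Proof.
rewrite -sum1_card (partition_big_imset (fun d : V * V => [set d.1; d.2])) /=.
rewrite mulnC -sum_nat_const; apply: eq_bigr => e /imsetP[[u v] uvG ->] /=.
have uv : u != v by apply: (dart_neq uvG).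
rewrite inE /= in uvG; rewrite sum1_card (_ : 2 = #|[set (u, v); (v, u)]|); last first.
  by rewrite cards2 xpair_eqE negb_and uv.
apply: eq_card => -[x y]; rewrite !inE !xpair_eqE /=.
apply/andP/idP=> [[xyG /eqP eq_xy]|/orP[] /andP[/eqP-> /eqP->]].
- rewrite /= in eq_xy; have xy : x != y by apply: (dart_neq xyG).
  have /orP[/eqP def_x|/eqP def_x] : (x == u) || (x == v) by rewrite -in_set2 -eq_xy set21.
    have : v \in [set x; y] by rewrite eq_xy set22.
    by rewrite in_set2 def_x [v == u]eq_sym (negbTE uv) /= => /eqP<-; rewrite !eqxx.
  have : u \in [set x; y] by rewrite eq_xy set21.
  by rewrite in_set2 def_x (negbTE uv) /= => /eqP<-; rewrite !eqxx orbT.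
- by rewrite inE /= eqxx.
- by rewrite inE /= adj_sym setUC eqxx.
Qed.

Lemma card_darts_faces (V : finType) (G : sgraph V) rot :
  rotation_system G rot ->
  (forall d, d \in darts G -> order (face_step rot) d = 3) ->
  #|darts G| = 3 * nb_faces G rot.
Proof.
move=> rotG order3; rewrite /nb_faces mulnC.
have injf := @face_step_inj V rot.
apply/esym/(fcard_order_set injf).
  by apply/subsetP => d dG; rewrite inE; apply/eqP/order3.
by move=> d e /eqP<-; rewrite face_step_darts.
Qed.

(** For an ear on both sides the rotation at [w] only exchanges [p w] and [s w], leaving degree at
    most 2. *)
Lemma ears_disjoint (V : finType) (G : sgraph V) rot (s p : V -> V) w :
    rotation_system G rot -> G w (p w) -> 2 < degree G w ->
    w \in side_ears rot s p -> w \notin side_ears rot p s.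
Proof.
move=> rotG wp degw; rewrite !inE => /eqP rp; apply: contraTN degw => /eqP rs.
rewrite -leqNgt /degree (leq_trans _ (_ : #|[set p w; s w]| <= 2)) //; last first.
  by rewrite cards2; case: eqP.
apply/subset_leq_card/subsetP=> x; rewrite inE => wx.
have [i ->] := rot_orbit rotG wp wx.
elim: i => [|i] /=; first by rewrite set21.
by rewrite !in_set2 => /orP[] /eqP->; rewrite ?rp ?rs eqxx ?orbT.
Qed.

(** The two sides are disjoint, since a common dart would lead to a common dart of the cycle. Each
    has at least 2n - 6 links among the 4n - 12 chord darts, so both attain the bound and have
    colourings. *)
Lemma two_sides (V : finType) (G : sgraph V) rot (s p : V -> V) :
    rotation_system G rot ->
    (forall d, d \in darts G -> order (face_step rot) d = 3) ->
    cancel s p -> cancel p s -> (forall v, G v (s v)) -> (forall v, s v != p v) ->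
    (forall u v, fconnect s u v) -> #|darts G| + 12 = 6 * #|V| -> V ->
  4 * domination_number G <= #|V| + #|side_ears rot s p| /\
  4 * domination_number G <= #|V| + #|side_ears rot p s|.
Proof.
move=> rotG order3 sK pK adj_s s_p s_conn card_darts v0.
have adj_pv := adj_p pK adj_s.
have p_s v : p v != s v by rewrite eq_sym.
have p_conn u v : fconnect p u v.
  have /iter_findex <- := s_conn v u; set i := findex _ _ _.
  have iK : iter i p (iter i s v) = v by elim: i => //= i IHi; rewrite -iterS iterSr sK.
  by rewrite -{2}iK fconnect_iter.
have [A sideA] : exists A, side G rot s p A.
  apply: (@exists_side _ _ _ _ _ rotG order3 sK pK adj_s s_p s_conn card_darts v0).
  move=> Y u v /closed_swap; exact: closed_all_succ.
have [B sideB] : exists B, side G rot p s B.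
  apply: (@exists_side _ _ _ _ _ rotG order3 pK sK adj_pv p_s p_conn card_darts v0).
  move=> Y u v /closed_swap; exact: closed_all_succ.
have disjAB : A :&: B = set0.
  case: sideA sideB => clA _ _ pA [/closed_swap clB _ _ sB].
  apply/setP=> d; rewrite in_set0; apply/negP=> dAB.
  have := closed_turn rotG adj_s (closedI clA clB) dAB.
  by rewrite !in_setI (negbTE (pA _)) (negbTE (sB _)) andbF; case.
have leA := side_links sideA; have leB := side_links sideB; rewrite links_swap in leB.
have disjL : links s p A :&: links s p B = set0.
  apply/setP=> d; rewrite in_setI !mem_links in_set0; apply/negP.
  case/andP=> /andP[dA _] /andP[dB _].
  by have := in_set0 d; rewrite -disjAB in_setI dA dB.
have leAB : #|links s p A| + #|links s p B| + 2 * #|V| <= #|darts G|.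
  rewrite -(card_chords pK adj_s s_p) leq_add2r -[_ + _]subn0.
  rewrite -[X in _ - X](cards0 (V * V)%type) -disjL -cardsU.
  apply: subset_leq_card; rewrite subUset !links_sub //.
    by case: sideB => -[].
  by case: sideA => -[].
split.
  apply: (side_domination rotG order3 pK adj_s sideA).
  by move: leA leB leAB card_darts; clear; card_lia.
apply: (side_domination rotG order3 sK adj_pv sideB).
by rewrite links_swap; move: leA leB leAB card_darts; clear; card_lia.
Qed.

Theorem theorem4p2 (V : finType) (n : nat) (G : sgraph V)
    (rot : V -> {perm V}) (H : seq V)
    (hn : #|V| = n)
    (hG : plane_triangulation G rot)
    (hdeg : 4 <= min_degree G)
    (hH : hamilton_cycle G H) :
  domination_number G <= maxn (ceil_div (2 * n) 7) (5 * n %/ 16).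
Proof.
case: hG => -[_ rotG euler] order3; case: hH => H_gt2 H_cyc H_uniq H_mem.
pose s := next H; pose p := prev H.
have sK : cancel s p by move=> v; apply: prev_next.
have pK : cancel p s by move=> v; apply: next_prev.
have adj_s v : G v (s v) by apply: (next_cycle H_cyc).
have szH : size H = n by rewrite -hn -(card_uniqP H_uniq); apply: eq_card.
have deg v : 2 < degree G v.
  by apply: leq_trans (leq_min_degree G v); apply: leq_trans hdeg.
have [v0 _] : exists v0 : V, true by case: (H) H_gt2 => // v0; exists v0.
have s_conn u v : fconnect s u v.
  by rewrite (fconnect_cycle (cycle_next H_uniq) (H_mem u)) H_mem.
have s_p v : s v != p v.
  apply: contraTneq H_gt2 => eq_sp; rewrite -leqNgt szH -hn.
  have ss : s (s v) = v by rewrite eq_sp pK.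
  rewrite -cardsT (leq_trans _ (_ : #|[set v; s v]| <= 2)) //; last by rewrite cards2; case: eqP.
  apply/subset_leq_card/subsetP=> x _; have /iter_findex <- := s_conn v x.
  elim: (findex _ _ _) => [|i] /=; first by rewrite set21.
  by rewrite !in_set2 => /orP[] /eqP->; rewrite ?ss eqxx ?orbT.
have card_darts : #|darts G| + 12 = 6 * #|V|.
  have := card_darts_faces rotG order3; have := card_darts_edges G.
  by move: euler; clear; card_lia.
have [domI domO] := two_sides rotG order3 sK pK adj_s s_p s_conn card_darts v0.
have pred_adj v : G v (p v) := adj_p pK adj_s v.
pose I := side_ears rot s p; pose O := side_ears rot p s.
have disj : I :&: O = set0.
  apply/setP=> w; rewrite in_setI in_set0; apply/negP=> /andP[wI].
  by apply/negP; apply: ears_disjoint rotG (pred_adj w) (deg w) wI.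
have cardIO : #|I :|: O| = #|I| + #|O| by rewrite cardsU disj cards0 subn0.
have le_IO : #|I| + #|O| <= n by rewrite -cardIO -hn max_card.
pose w := [seq v \in I :|: O | v <- H].
have sz_w : size w = n by rewrite size_map.
have count_w : count id w = #|I| + #|O|.
  rewrite count_map -cardIO -size_filter -(card_uniqP (filter_uniq _ H_uniq)).
  by apply: eq_card => v; rewrite mem_filter H_mem andbT.
have count_nw : count negb w = n - (#|I| + #|O|).
  by rewrite -count_w -sz_w -(count_id_negb w) addKn.
have domL : 6 < n -> dense w -> domination_number G <= 5 * n %/ 16.
  move=> n_gt6 dense_w; have [_ minD] := domination_number_min G.
  have [|||D leD domD] := @dense_dominated V G s (mem (I :|: O)) H adj_s _ H_uniq H_mem _ _ dense_w.
  - move=> v /=; rewrite in_setU.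
    case/orP=> [/(ear_adj rotG order3 pK adj_s)|/(ear_adj rotG order3 sK pred_adj)].
      by rewrite sK.
    by rewrite sK adj_sym.
  - by [].
  - by rewrite szH.
  by rewrite -szH; apply: leq_trans leD; apply/minD/dominating_dominated.
rewrite leq_max; move: domL domI domO le_IO.
rewrite -/I -/O hn /dense sz_w count_w count_nw /ceil_div.
move: (domination_number G) #|I| #|O| H_gt2; rewrite szH; clear => g i o n_gt2 domL domI domO le_io.
(* The two ear bounds and [i + o <= n] give [8 * g <= 3 * n], enough for [n <= 6]. *)
have [n_gt6|n_le6] := ltnP 6 n; last by lia.
have [dense_w|/ltnW not_dense] := leqP (16 * (5 * n %/ 16).+1) (6 * (i + o) + 4 * (n - (i + o))).
  by rewrite domL ?orbT.
(* The ear bounds add up to [16 * g <= 4 * n + 2 * (i + o)], so [g] could exceed [5 * n %/ 16] only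
   for a dense word, where [domL] applies. *)
by lia.
Qed.
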